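(* Let $C\subseteq\mathbb{R}^d$ be the attractor of an affine, rational-preserving iterated function system $F=(f_1,\ldots,f_J)$. Then any vector in $C$ that admits an ultimately periodic address is in $\mathbb{Q}^d$. If moreover the iterated function system is unimodular, then the rational vectors in $C$ (elements of $C\cap\mathbb{Q}^d$) are precisely those vectors in $C$ that have an ultimately periodic address. Moreover, in this case, for every $\underline{p}/q\in\mathbb{Q}^d\cap C$ an ultimately periodic address can be chosen whose period length (including the preperiod) is $\ll_C\min\{q^D,q^d\}$, where $D=-\log J/\log\tau$, $\tau=\max_{1\leq j\leq J}\tau_j$, and the implied constant depends only on $C$ (the iterated function system).
   Context: $\mathbb{R}^d$ carries the supremum norm $\Vert\cdot\Vert$. An iterated function system (IFS) is a finite set of contractions $f_j:\mathbb{R}^d\to\mathbb{R}^d$, i.e. maps with $\Vert f_j(\underline{x})-f_j(\underline{y})\Vert\leq\tau_j\Vert\underline{x}-\underline{y}\Vert$ for some contraction rate $\tau_j\in(0,1)$; its attractor is the unique nonempty compact set $C$ with $\bigcup_{j}f_j(C)=C$. The IFS is affine if $f_j(\underline{y})=A_j\underline{y}+\underline{b}_j$ with $A_j\in\mathbb{R}^{d\times d}$, $\underline{b}_j\in\mathbb{R}^d$, and rational-preserving if $f_j(\mathbb{Q}^d)\subseteq\mathbb{Q}^d$ for all $j$. An affine, rational-preserving IFS is unimodular if $f_j(\underline{y})=A_j\underline{y}/q_j+\underline{b}_j/s_j$ with $A_j\in\mathbb{Z}^{d\times d}$, $\det(A_j)\in\{1,-1\}$, $\underline{b}_j\in\mathbb{Z}^d$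 and $q_j,s_j\in\mathbb{N}$. An address of $\underline{\xi}\in C$ is a sequence $(\omega_1,\omega_2,\ldots)\in\{1,\ldots,J\}^{\mathbb{N}}$ with $\underline{\xi}=\lim_{i\to\infty}f_{\omega_1}\circ\cdots\circ f_{\omega_i}(\underline{0})$; it is ultimately periodic if it consists of a finite (possibly empty) preperiod followed by a finite word repeated forever, and the period length including preperiod is the sum of the lengths of the preperiod and of the period word. Rational vectors are written $\underline{p}/q$ with $\underline{p}\in\mathbb{Z}^d$, $q\in\mathbb{N}$. *)

(* Defs.v *)
From HB Require Import structures.
From mathcomp Require Import all_boot all_order all_algebra.
From mathcomp Require Import all_classical all_reals all_analysis.

Set Implicit Arguments.
Unset Strict Implicit.
Unset Printing Implicit Defensive.
Import Order.TTheory GRing.Theory Num.Theory.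
Import numFieldNormedType.Exports.
Local Open Scope classical_set_scope.
Local Open Scope ring_scope.

Section IteratedFunctionSystems.
Context {R : realType} {d J : nat}.
Implicit Types (f : 'I_J -> 'cV[R]_d -> 'cV[R]_d) (C : set 'cV[R]_d).
Implicit Types (tau : 'I_J -> R) (x : 'cV[R]_d) (w : nat -> 'I_J).

(* The norm that MathComp-Analysis puts on 'cV[R]_d is the supremum norm. *)
Definition contraction_rates f tau : Prop :=
  forall j, 0 < tau j < 1 /\
            forall x y, `|f j x - f j y| <= tau j * `|x - y|.

Definition is_ifs f : Prop := exists tau, contraction_rates f tau.

Definition is_attractor f C : Prop :=
  [/\ C !=set0, compact C & \bigcup_j (f j @` C) = C].

Definition rational_vectors : set 'cV[R]_d :=
  [set x | exists r : 'cV[rat]_d, x = map_mx ratr r].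

Definition affine_ifs f : Prop :=
  forall j, exists (A : 'M[R]_d) (b : 'cV[R]_d), forall y, f j y = A *m y + b.

Definition rational_preserving f : Prop :=
  forall j, f j @` rational_vectors `<=` rational_vectors.

Definition vec_frac (p : 'cV[int]_d) (q : nat) : 'cV[R]_d :=
  q%:R^-1 *: map_mx intr p.

Definition unimodular f : Prop :=
  forall j, exists (A : 'M[int]_d) (b : 'cV[int]_d) (q s : nat),
    [/\ \det A = 1 \/ \det A = -1, (0 < q)%N, (0 < s)%N &
        forall y, f j y = q%:R^-1 *: (map_mx intr A *m y) + vec_frac b s].

(* f_(w 0) \o ... \o f_(w n.-1); the last letter is applied first. *)
Fixpoint word_comp f w (n : nat) : 'cV[R]_d -> 'cV[R]_d :=
  if n is n'.+1 then word_comp f w n' \o f (w n') else id.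

Definition is_address f w x : Prop :=
  word_comp f w n 0 @[n --> \oo] --> x.

(* Preperiod of length m followed by a word of length n repeated forever;
   neither length is required to be minimal. *)
Definition periodic_after w (m n : nat) : Prop :=
  (0 < n)%N /\ forall i, (m <= i)%N -> w (i + n)%N = w i.

Definition ultimately_periodic w : Prop := exists m n, periodic_after w m n.

Definition max_rate tau : R := \big[Num.max/0]_j tau j.

Definition ifs_dim tau : R := - ln J%:R / ln (max_rate tau).

End IteratedFunctionSystems.

Arguments rational_vectors : clear implicits.

(* Main.v *)
(* A vector with an ultimately periodic address is the image, under a
   rational-preserving affine map, of the fixed point of an affine rational
   contraction y |-> A y + b; as 1 - A is injective, that fixed point solves an
   invertible rational linear system.

   Conversely, follow an orbit x_0 = p/q, x_k = f_(w k) x_(k+1) backwards inside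
   C.  In the unimodular case the inverse maps preserve (1/Q) Z^d for Q = q S,
   S being a common multiple of the s_j, so two of the points x_k coincide and
   the address becomes periodic.  The time of the first collision is at most the
   number of points of C in (1/Q) Z^d, which is bounded both by counting
   coordinates (order q^d) and by counting words of length k, where k is minimal
   such that cylinders of level k have diameter less than 1/Q (order q^D). *)
Require Import Defs.
From HB Require Import structures.
From mathcomp Require Import all_boot all_order all_algebra.
From mathcomp Require Import all_classical all_reals all_analysis.
From mathcomp Require Import zify.
Import Order.TTheory GRing.Theory Num.Theory.
Import numFieldNormedType.Exports.
Local Open Scope classical_set_scope.
Local Open Scope ring_scope.

(** * Contraction estimates and compositions along a word *)

Lemma entry_le_norm {R : realType} {m n : nat} (x : 'M[R]_(m, n)) i j :
  `|x i j| <= `|x|.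
Proof.
rewrite [leRHS]mx_normrE.
exact: (le_bigmax _ (fun ij : 'I_m * 'I_n => `|x ij.1 ij.2|) (i, j)).
Qed.

Lemma geometric_lt {R : realType} (t c e : R) : 0 <= t < 1 -> 0 < e ->
  exists N, forall n, (N <= n)%N -> t ^+ n * c < e.
Proof.
move=> /andP[t_ge0 t_lt1] e_gt0.
have : (t ^+ n * c) @[n --> \oo] --> (0 : R).
  rewrite -[0](mul0r c); apply: cvgMr_tmp; apply: cvg_expr.
  by rewrite ger0_norm.
move/cvgrPdist_lt => /(_ _ e_gt0) [N _ NP]; exists N => n /NP.
by rewrite /= sub0r normrN; apply: le_lt_trans; exact: ler_norm.
Qed.

Lemma contraction_max_rate {R : realType} {d J : nat}
    {f : 'I_J -> 'cV[R]_d -> 'cV[R]_d} {tau : 'I_J -> R} :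
  (0 < J)%N -> contraction_rates f tau ->
  0 < max_rate tau < 1 /\
  forall j x y, `|f j x - f j y| <= max_rate tau * `|x - y|.
Proof.
move=> J_gt0 ftau.
have tau_le j : tau j <= max_rate tau by exact: le_bigmax.
split=> [|j x y].
  apply/andP; split.
    have [/andP[+ _] _] := ftau (Ordinal J_gt0) => /lt_le_trans; apply.
    exact: tau_le.
  by apply: bigmax_lt => // j _; have [/andP[]] := ftau j.
have [_ fj] := ftau j; apply: le_trans (fj x y) _.
by rewrite ler_wpM2r.
Qed.

Lemma word_comp_lipschitz {R : realType} {d J : nat}
    {f : 'I_J -> 'cV[R]_d -> 'cV[R]_d} {t : R} w n x y :
  0 <= t -> (forall j x y, `|f j x - f j y| <= t * `|x - y|) ->
  `|word_comp f w n x - word_comp f w n y| <= t ^+ n * `|x - y|.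
Proof.
move=> t_ge0 ft; elim: n x y => [|n IHn] x y /=; first by rewrite expr0 mul1r.
apply: le_trans (IHn _ _) _.
by rewrite exprSr -mulrA ler_wpM2l ?exprn_ge0.
Qed.

Lemma word_comp_cat {R : realType} {d J : nat}
    (f : 'I_J -> 'cV[R]_d -> 'cV[R]_d) w m n x :
  word_comp f w (m + n) x =
  word_comp f w m (word_comp f (fun i => w (m + i)%N) n x).
Proof. by elim: n x => [|n IHn] x; rewrite ?addn0 ?addnS //= IHn. Qed.

Lemma eq_word_comp {R : realType} {d J : nat}
    (f : 'I_J -> 'cV[R]_d -> 'cV[R]_d) w v n x :
  (forall i, (i < n)%N -> w i = v i) -> word_comp f w n x = word_comp f v n x.
Proof.
elim: n x => //= n IHn x wv; rewrite wv// IHn// => i /ltnW; exact: wv.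
Qed.

Lemma word_comp_affine {R : realType} {d J : nat}
    {f : 'I_J -> 'cV[R]_d -> 'cV[R]_d} w n : affine_ifs f ->
  exists (A : 'M[R]_d) (b : 'cV[R]_d), forall y, word_comp f w n y = A *m y + b.
Proof.
move=> faff; elim: n => [|n [A [b wE]]].
  by exists 1%:M, 0 => y /=; rewrite mul1mx addr0.
have [B [c fE]] := faff (w n).
by exists (A *m B), (A *m c + b) => y /=; rewrite wE fE mulmxDr mulmxA addrA.
Qed.

Lemma word_comp_rational {R : realType} {d J : nat}
    {f : 'I_J -> 'cV[R]_d -> 'cV[R]_d} w n x : rational_preserving f ->
  rational_vectors R d x -> rational_vectors R d (word_comp f w n x).
Proof. by move=> fr; elim: n x => //= n IHn x xr; apply/IHn/fr; exists x. Qed.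

(** * Rationality of points with an ultimately periodic address *)

Lemma rational_fixed_point {R : realType} {d : nat}
    (g : 'cV[R]_d -> 'cV[R]_d) (A : 'M[R]_d) (b : 'cV[R]_d) (t : R) :
  (forall y, g y = A *m y + b) -> t < 1 ->
  (forall x y, `|g x - g y| <= t * `|x - y|) ->
  (forall x, rational_vectors R d x -> rational_vectors R d (g x)) ->
  exists2 y, rational_vectors R d y & g y = y.
Proof.
move=> gE t_lt1 gt grat.
(* The entries of [b] and [A] are rational because [b] is [g 0] and [col i A + b] is the value of
   [g] at the [i]-th basis vector. *)
have [b0 b0E] : rational_vectors R d b.
  rewrite -[b]add0r -[0](mulmx0 _ A) -gE; apply: grat; exists 0.
  by rewrite map_mx0.
have colA (i : 'I_d) : exists r : 'cV[rat]_d, col i A + b = map_mx ratr r.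
  by rewrite colE -gE; apply: grat; exists (delta_mx i 0); rewrite map_delta_mx.
have [c cE] := choice colA.
pose A0 : 'M[rat]_d := \matrix_(i, j) (c j i 0 - b0 i 0).
have AE : A = map_mx ratr A0.
  apply/matrixP => i j; rewrite !mxE rmorphB/=.
  move/matrixP/(_ i 0): (cE j); move/matrixP/(_ i 0): b0E.
  by rewrite !mxE => <- <-; rewrite addrK.
(* A nonzero vector fixed by [A] would have an image under [g] at the same distance from [g 0] as it
   has from 0, against [t < 1]. *)
have unitA : 1%:M - A \in unitmx.
  rewrite -unitmx_tr unitmxE unitfE; apply/det0P => -[v v_neq0].
  move=> /(congr1 trmx); rewrite trmx_mul trmxK trmx0 mulmxBl mul1mx.
  move=> /eqP; rewrite subr_eq0 => /eqP vE.
  have := gt v^T 0; rewrite !gE mulmx0 add0r addrK -vE subr0.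
  rewrite -subr_ge0 -{2}[`|_|]mul1r -mulrBl pmulr_lge0 ?normr_gt0.
    by rewrite subr_ge0 leNgt t_lt1.
  by rewrite -trmx0 (inj_eq trmx_inj).
exists (invmx (1%:M - A) *m b).
  exists (invmx (1%:M - A0) *m b0).
  by rewrite map_mxM map_invmx map_mxB map_mx1 -AE -b0E.
set y := _ *m b; have : (1%:M - A) *m y = b by rewrite mulKVmx.
by rewrite gE mulmxBl mul1mx => <-; rewrite addrC subrK.
Qed.

Lemma periodic_shift {T : Type} {w : nat -> T} {m n : nat} :
  (forall i, (m <= i)%N -> w (i + n)%N = w i) ->
  forall k i, w (m + k * n + i)%N = w (m + i)%N.
Proof.
move=> wper; elim=> [|k IHk] i; first by rewrite mul0n addn0.
rewrite -[RHS]IHk -[RHS]wper; last by rewrite -addnA leq_addr.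
by congr w; rewrite mulSn; lia.
Qed.

(** The limit along an address does not depend on the base point, so 0 may be replaced by the
    rational fixed point [y] of the period block. Along the lengths [m + k * n] the composition at
    [y] is constant, hence equal to the limit. *)
Lemma periodic_address_rational {R : realType} {d J : nat}
    {f : 'I_J -> 'cV[R]_d -> 'cV[R]_d} {w x} :
  is_ifs f -> affine_ifs f -> rational_preserving f ->
  is_address f w x -> ultimately_periodic w -> rational_vectors R d x.
Proof.
move=> [tau ftau] faff frat wx [m [n [n_gt0 wper]]].
have J_gt0 : (0 < J)%N by rewrite (leq_ltn_trans _ (ltn_ord (w 0%N))).
have [/andP[t_gt0 t_lt1] ft] := contraction_max_rate J_gt0 ftau.
set t := max_rate tau in t_gt0 t_lt1 ft.
pose v i := w (m + i)%N.
have [A [b gE]] := word_comp_affine v n faff.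
have [|||y yrat gy] := rational_fixed_point _ _ _ (t ^+ n) gE.
- by rewrite exprn_ilt1 ?ltW// -lt0n.
- by move=> y z; apply: word_comp_lipschitz => //; exact: ltW.
- by move=> y; exact: word_comp_rational.
have loop k : word_comp f w (m + k * n) y = word_comp f w m y.
  elim: k => [|k IHk]; first by rewrite addn0.
  rewrite mulSn [(n + _)%N]addnC addnA word_comp_cat -IHk.
  congr (word_comp _ _ _ _); rewrite -[RHS]gy.
  by apply: eq_word_comp => i _; rewrite periodic_shift.
suff -> : x = word_comp f w m y by exact: word_comp_rational.
apply/eqP; rewrite -subr_eq0 -normr_le0; apply/ler_addgt0Pr => e e_gt0.
have e2 : 0 < e / 2 by rewrite divr_gt0.
rewrite add0r.
move/cvgrPdist_lt: wx => /(_ _ e2) [N1 _ N1P].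
have [|N2 N2P] := geometric_lt t `|y| _ _ e2; first by rewrite ltW.
(* Since [n] is positive, [l] is at least [k] and so exceeds both thresholds; each of the two
   distances is then below [e / 2]. *)
pose k := (N1 + N2)%N; pose l := (m + k * n)%N.
have kl : (k <= l)%N.
  by rewrite (leq_trans (leq_pmulr k n_gt0))// leq_addl.
have l1 : (N1 <= l)%N by apply: leq_trans kl; exact: leq_addr.
have l2 : (N2 <= l)%N by apply: leq_trans kl; exact: leq_addl.
rewrite -(loop k) -/l [e]splitr ltW//.
apply: le_lt_trans (ler_distD (word_comp f w l 0) _ _) _.
apply: ltrD; first exact: N1P.
apply: le_lt_trans (word_comp_lipschitz _ _ _ _ (ltW t_gt0) ft) _.
by rewrite sub0r normrN N2P.
Qed.

(** * Backward orbits: addresses, denominators and collisions *)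

(** Unrolling the chain gives [z 0 = word_comp f w k (z k)]; moving the base point from [z k] to 0
    costs at most [t ^+ k * M]. *)
Lemma bounded_chain_address {R : realType} {d J : nat}
    {f : 'I_J -> 'cV[R]_d -> 'cV[R]_d} {t M : R} (w : nat -> 'I_J)
    (z : nat -> 'cV[R]_d) :
  0 <= t < 1 -> (forall j x y, `|f j x - f j y| <= t * `|x - y|) ->
  (forall k, z k = f (w k) (z k.+1)) -> (forall k, `|z k| <= M) ->
  is_address f w (z 0%N).
Proof.
move=> /andP[t_ge0 t_lt1] ft zE zM.
have chain k : z 0%N = word_comp f w k (z k).
  by elim: k => //= k IHk; rewrite -zE.
apply/cvgrPdist_lt => e e_gt0.
have [|N NP] := geometric_lt t M _ _ e_gt0; first by rewrite t_ge0.
exists N => // k Nk /=.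
rewrite (chain k); apply: le_lt_trans (word_comp_lipschitz _ _ _ _ t_ge0 ft) _.
by apply: le_lt_trans (NP k Nk); rewrite subr0 ler_wpM2l ?exprn_ge0.
Qed.

(** The inverse of [A] is an integer matrix, and inverting the map multiplies by [q] instead of
    dividing by it. The only denominator that could enter is [s], which already divides [Q]. *)
Lemma unimodular_preimage_frac {R : realType} {d : nat} {A : 'M[int]_d}
    {b u : 'cV[int]_d} {q s Q : nat} {y : 'cV[R]_d} :
  \det A = 1 \/ \det A = -1 -> (0 < q)%N -> (0 < Q)%N -> (s %| Q)%N ->
  vec_frac u Q = q%:R^-1 *: (map_mx intr A *m y) + vec_frac b s ->
  exists v, y = vec_frac v Q.
Proof.
move=> detA q_gt0 Q_gt0 /dvdnP[r QE] uE.
have Aunit : A \in unitmx by rewrite unitmxE; case: detA => ->.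
have q_neq0 : q%:R != 0 :> R by rewrite pnatr_eq0 -lt0n.
have r_neq0 : r%:R != 0 :> R.
  by rewrite pnatr_eq0; apply: contraTneq Q_gt0 => r0; rewrite QE r0.
exists (invmx A *m (q%:Z *: (u - r%:Z *: b))).
have AyE : map_mx intr A *m y = q%:R *: (vec_frac u Q - vec_frac b s).
  by rewrite uE addrK scalerA mulfV// scale1r.
have -> : y = map_mx intr (invmx A) *m (map_mx intr A *m y).
  by rewrite mulmxA -map_mxM mulVmx// map_mx1 mul1mx.
rewrite AyE /vec_frac map_mxM [RHS]scalemxAr; congr (_ *m _).
rewrite map_mxZ map_mxB map_mxZ scalerA [Q%:R^-1 * _]mulrC -scalerA.
congr (_ *: _); rewrite scalerBr; congr (_ - _).
rewrite /= scalerA QE natrM invfM -[(Posz r)%:~R]/(r%:R).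
by rewrite mulrAC mulVf// mul1r.
Qed.

Lemma unimodular_common_denominator {R : realType} {d J : nat}
    {f : 'I_J -> 'cV[R]_d -> 'cV[R]_d} : unimodular f ->
  exists2 S, (0 < S)%N & forall Q j u y, (0 < Q)%N -> (S %| Q)%N ->
    vec_frac u Q = f j y -> exists v, y = vec_frac v Q.
Proof.
move=> funi.
have /choice[s sP] : forall j, exists s, (0 < s)%N /\
    forall Q u y, (0 < Q)%N -> (s %| Q)%N ->
      vec_frac u Q = f j y -> exists v, y = vec_frac v Q.
  move=> j; have [A [b [q [s [detA q_gt0 s_gt0 fE]]]]] := funi j.
  exists s; split=> // Q u y Q_gt0 sQ; rewrite fE.
  exact: unimodular_preimage_frac.
exists (\prod_j s j)%N; first by apply: prodn_gt0 => j; have [] := sP j.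
move=> Q j u y Q_gt0 SQ; have [_] := sP j; apply=> //.
by apply: dvdn_trans SQ; rewrite (bigD1 j)//= dvdn_mulr.
Qed.

Lemma orbit_collision {T : Type} {F : finType} (P : T -> Prop) (g : T -> T)
    (code : T -> F) x :
  P x -> (forall y, P y -> P (g y)) ->
  (forall y z, P y -> P z -> code y = code z -> y = z) ->
  exists m n, [/\ (0 < n)%N, (m + n <= #|F|)%N &
                  iter (m + n) g x = iter m g x].
Proof.
move=> Px Pg codeI.
have Piter i : P (iter i g x) by elim: i => //= i; exact: Pg.
(* Pigeonhole on the orbit points with indices 0 to [#|F|]: the larger colliding index, which
   becomes [m + n], is at most [#|F|]. *)
pose h (i : 'I_#|F|.+1) := code (iter i g x).
have /injectivePn[i [j ij hij]] : ~~ injectiveb h.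
  by apply/injectiveP => /leq_card; rewrite card_ord ltnn.
wlog lt_ij : i j ij hij / (i < j)%N.
  move=> H; case: (ltngtP i j) => [||/val_inj]; first exact: H.
    by apply: H => //; rewrite eq_sym.
  by move=> ijE; rewrite ijE eqxx in ij.
exists (val i), (j - i)%N; rewrite subnKC ?(ltnW lt_ij)//.
split; first by rewrite subn_gt0.
  by rewrite -ltnS ltn_ord.
exact: codeI (Piter j) (Piter i) (esym hij).
Qed.

(** * Points with a fixed denominator, and the length of separating words *)

Lemma vec_frac_scaled_entry {R : realType} {d : nat} (u : 'cV[int]_d) (Q : nat)
    i : (0 < Q)%N -> Q%:R * (vec_frac u Q : 'cV[R]_d) i 0 = (u i 0)%:~R.
Proof. by move=> Q_gt0; rewrite !mxE mulrA mulfV ?mul1r// pnatr_eq0 -lt0n. Qed.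

Lemma vec_frac_separated {R : realType} {d : nat} (u v : 'cV[int]_d) (Q : nat) :
  (0 < Q)%N -> Q%:R * `|vec_frac u Q - vec_frac v Q : 'cV[R]_d| < 1 ->
  vec_frac u Q = vec_frac v Q :> 'cV[R]_d.
Proof.
move=> Q_gt0 close; congr vec_frac; apply/matrixP => i j; rewrite ord1.
apply/eqP; rewrite -subr_eq0 -absz_eq0 -leqn0 -ltnS -ltz_nat abszE.
rewrite -(ltr_int R) intr_norm rmorphB /=.
apply: le_lt_trans close; rewrite -!(@vec_frac_scaled_entry R _ _ Q)//.
rewrite -mulrBr normrM normr_nat ler_wpM2l//.
have := entry_le_norm (vec_frac u Q - vec_frac v Q : 'cV[R]_d) i 0.
by rewrite !mxE.
Qed.

(** The numerators lie between [- Q * M] and [Q * M]; the shift makes them natural numbers, usable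
    as ordinals in [coordinate_code]. *)
Lemma vec_frac_shifted_entry {R : realType} {d : nat} (u : 'cV[int]_d)
    (Q M : nat) i :
  (0 < Q)%N -> `|vec_frac u Q : 'cV[R]_d| <= M%:R ->
  exists2 k, (k <= 2 * (Q * M))%N &
    Q%:R * (vec_frac u Q : 'cV[R]_d) i 0 + (Q * M)%:R = k%:R.
Proof.
move=> Q_gt0 uM.
have : `|u i 0| <= (Q * M)%:Z.
  rewrite -(ler_int R) intr_norm -(@vec_frac_scaled_entry R _ _ Q)//.
  rewrite normrM normr_nat -pmulrn natrM ler_wpM2l//.
  exact: le_trans (entry_le_norm _ _ _) uM.
move=> uB; pose k := `|(u i 0 + (Q * M)%N%:Z)%R|%N.
exists k; first by rewrite /k; lia.
have /(congr1 (fun z : int => z%:~R : R)) : k%:Z = u i 0 + (Q * M)%:Z.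
  by rewrite /k; lia.
by rewrite vec_frac_scaled_entry// rmorphD.
Qed.

(** Take the least [k] with [t ^+ k * L < 1]. If [k] is positive, minimality gives
    [1 <= t ^+ k.-1 * L]; raising this to the power [D], where [t]^ D[is the inverse of]J[, bounds]J
    ^ k.-1[by]L [^ D]. The factor [J] pays for the last letter. *)
Lemma word_length {R : realType} (J : nat) (t L : R) :
  (0 < J)%N -> 0 < t < 1 -> 1 <= L ->
  exists2 k, t ^+ k * L < 1 & (J ^ k)%:R <= J%:R * L `^ (- ln J%:R / ln t).
Proof.
move=> J_gt0 /andP[t_gt0 t_lt1] L_ge1.
have lnt : ln t < 0 by apply: ln_lt0; rewrite t_gt0.
have J_ge1 : 1 <= J%:R :> R by rewrite ler1n.
have L_gt0 : 0 < L by exact: lt_le_trans L_ge1.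
set D := - ln J%:R / ln t.
have D_ge0 : 0 <= D.
  by rewrite /D mulNr -mulrN mulr_ge0 ?ln_ge0// oppr_ge0 invr_le0 ltW.
have tD : t `^ D = J%:R^-1.
  rewrite /powR gt_eqF// /D mulfVK ?lt_eqF// expRN lnK// posrE.
  by rewrite ltr0n.
clearbody D.
have [|N NP] := geometric_lt t L _ _ (@ltr01 R); first by rewrite ltW.
have : exists k, t ^+ k * L < 1 by exists N; exact: NP.
move=> /ex_minnP[k kP kmin]; exists k => //.
have LD_ge1 : 1 <= L `^ D by rewrite -(powRr0 L) ler_powR.
case: k kP kmin => [|k] _ kmin; first by rewrite expn0 mulr_ege1.
rewrite expnS natrM ler_wpM2l// natrX.
have {}kmin : 1 <= t ^+ k * L.
  by rewrite leNgt; apply/negP => /kmin; rewrite ltnn.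
have t_ge0 := ltW t_gt0.
have : 1 <= (t ^+ k * L) `^ D by rewrite -(powRr0 (t ^+ k * L)) ler_powR.
rewrite powRM ?exprn_ge0 ?(ltW L_gt0)// -powR_mulrn// -powRrM mulrC.
rewrite [k%:R * D]mulrC powRrM tD powR_mulrn ?invr_ge0 ?ler0n//.
rewrite exprVn ler_pdivlMr ?mul1r//.
by rewrite exprn_gt0// ltr0n.
Qed.

Lemma rational_vector_frac {R : realType} {d : nat} (x : 'cV[R]_d) :
  rational_vectors R d x ->
  exists (p : 'cV[int]_d) (q : nat), (0 < q)%N /\ x = vec_frac p q.
Proof.
move=> [r ->]; pose q := \prod_i denq (r i 0).
have q_gt0 : 0 < q by apply: prodr_gt0.
exists (\col_i (numq (r i 0) * \prod_(j | j != i) denq (r j 0))), `|q|%N.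
split; first by rewrite absz_gt0 gt_eqF.
apply/matrixP => i j; rewrite ord1 !mxE.
have -> : `|q|%:R = q%:~R :> R by rewrite pmulrn gtz0_abs.
have dneq0 k : (denq (r k 0))%:~R != 0 :> R by rewrite intr_eq0 denq_neq0.
rewrite /q (bigD1 i)//= !rmorphM/= /ratr invfM mulrAC [LHS]mulrC -!mulrA.
congr (_ * _); rewrite mulfV ?mulr1// rmorph_prod/=.
by rewrite prodf_seq_neq0; apply/allP => k _; rewrite dneq0 implybT.
Qed.

(** * Periodic addresses from finite codes *)

(** Letter and preimage are functions of the point, so once an orbit point recurs, all later letters
    recur with it. Any code injective on [P] bounds the time of recurrence, which lets the two
    counts share this argument. *)
Lemma backward_orbit_address {R : realType} {d J : nat}
    {f : 'I_J -> 'cV[R]_d -> 'cV[R]_d} {t M : R} (P : 'cV[R]_d -> Prop)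
    (letter : 'cV[R]_d -> 'I_J) (pre : 'cV[R]_d -> 'cV[R]_d) {F : finType}
    (code : 'cV[R]_d -> F) x :
  0 <= t < 1 -> (forall j y z, `|f j y - f j z| <= t * `|y - z|) ->
  (forall y, P y -> [/\ `|y| <= M, P (pre y) & y = f (letter y) (pre y)]) ->
  (forall y z, P y -> P z -> code y = code z -> y = z) -> P x ->
  exists w m n, [/\ is_address f w x, periodic_after w m n &
                    (m + n <= #|F|)%N].
Proof.
move=> t01 ft Ppre codeI Px.
have Piter k : P (iter k pre x) by elim: k => //= k /Ppre[].
have [|m [n [n_gt0 mn loop]]] := orbit_collision P pre code x Px _ codeI.
  by move=> y /Ppre[].
exists (fun k => letter (iter k pre x)), m, n; split=> //.
  apply: (bounded_chain_address _ (fun k => iter k pre x) t01 ft (M := M)).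
    by move=> k; have [] := Ppre _ (Piter k).
  by move=> k; have [] := Ppre _ (Piter k).
split=> // i mi; rewrite -(subnK mi) -addnA.
by rewrite iterD loop -iterD.
Qed.

Lemma coordinate_code {R : realType} (d Q M : nat) : (0 < Q)%N ->
  exists code : 'cV[R]_d -> {ffun 'I_d -> 'I_(2 * (Q * M)).+1},
  forall u v, `|vec_frac u Q : 'cV[R]_d| <= M%:R ->
    `|vec_frac v Q : 'cV[R]_d| <= M%:R ->
    code (vec_frac u Q) = code (vec_frac v Q) ->
    vec_frac u Q = vec_frac v Q :> 'cV[R]_d.
Proof.
move=> Q_gt0.
(* On the points considered, the truncated number is a natural number at most [2 * (Q * M)], so
   neither [Num.trunc] nor [inord] loses information. *)
exists (fun x => [ffun i => inord (Num.trunc (Q%:R * x i 0 + (Q * M)%:R))]).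
move=> u v uM vM /ffunP codeE; apply/matrixP => i j; rewrite ord1.
have := codeE i; rewrite !ffunE.
have [k kB kE] := vec_frac_shifted_entry u Q M i Q_gt0 uM.
have [l lB lE] := vec_frac_shifted_entry v Q M i Q_gt0 vM.
rewrite kE lE !natrK => /(congr1 val); rewrite /= !inordK ?ltnS// => kl.
move: kE; rewrite kl -lE => /addIr; apply: mulfI.
by rewrite pnatr_eq0 -lt0n.
Qed.

(** Two points with the same first [k] letters are images of points of norm at most [M] under one
    composition, so their distance is at most [t ^+ k * (2 * M)]. This is below [1 / Q], the least
    distance between distinct points with denominator [Q]. *)
Lemma word_code {R : realType} {d J : nat}
    {f : 'I_J -> 'cV[R]_d -> 'cV[R]_d} {t : R} (P : 'cV[R]_d -> Prop)
    (letter : 'cV[R]_d -> 'I_J) (pre : 'cV[R]_d -> 'cV[R]_d) (Q M k : nat) :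
  0 <= t -> (forall j y z, `|f j y - f j z| <= t * `|y - z|) ->
  (forall y, P y -> [/\ `|y| <= M%:R, P (pre y) & y = f (letter y) (pre y)]) ->
  (0 < Q)%N -> (forall y, P y -> exists u, y = vec_frac u Q) ->
  t ^+ k * (2 * (Q * M))%:R < 1 ->
  exists code : 'cV[R]_d -> {ffun 'I_k -> 'I_J},
  forall y z, P y -> P z -> code y = code z -> y = z.
Proof.
move=> t_ge0 ft Ppre Q_gt0 Pfrac tk.
exists (fun y => [ffun i : 'I_k => letter (iter i pre y)]) => y z Py Pz.
move=> /ffunP codeE.
have Piter x l : P x -> P (iter l pre x) by move=> Px; elim: l => //= l /Ppre[].
have unfold x l : P x ->
    x = word_comp f (fun i => letter (iter i pre x)) l (iter l pre x).
  move=> Px; elim: l => //= l {1}->.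
  by have [_ _ {1}->] := Ppre _ (Piter x l Px).
have [[u yE] [v zE]] := (Pfrac _ Py, Pfrac _ Pz).
rewrite yE zE; apply: vec_frac_separated => //; rewrite -yE -zE.
apply: le_lt_trans tk.
rewrite (unfold y k Py) (unfold z k Pz).
rewrite (eq_word_comp _ _ (fun i => letter (iter i pre z))); last first.
  by move=> i ik; have := codeE (Ordinal ik); rewrite !ffunE.
rewrite mulnCA natrM mulrCA ler_wpM2l//.
apply: le_trans (word_comp_lipschitz _ _ _ _ t_ge0 ft) _.
rewrite ler_wpM2l ?exprn_ge0// mul2n -addnn natrD.
apply: le_trans (ler_normB _ _) (lerD _ _).
  by have [] := Ppre _ (Piter _ k Py).
by have [] := Ppre _ (Piter _ k Pz).
Qed.

(** * The attractor and the uniform length bound *)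

Lemma attractor_backward_orbits {R : realType} {d J : nat}
    {f : 'I_J -> 'cV[R]_d -> 'cV[R]_d} {C : set 'cV[R]_d} :
  is_attractor f C ->
  [/\ (0 < J)%N, exists2 M, (0 < M)%N & forall x, C x -> `|x| <= M%:R &
    exists (letter : 'cV[R]_d -> 'I_J) (pre : 'cV[R]_d -> 'cV[R]_d),
      forall x, C x -> C (pre x) /\ x = f (letter x) (pre x)].
Proof.
move=> [[x0 Cx0] Ccompact CE].
have Cpre x : C x -> exists j y, C y /\ x = f j y.
  by rewrite -{1}CE => -[j _ [y Cy <-]]; exists j, y.
have [j0 _] := Cpre _ Cx0.
split; first exact: leq_ltn_trans (ltn_ord j0).
  have [B [_ CB]] := compact_bounded Ccompact.
  (* [compact_bounded] gives a bound by every number above [B]; [B + 1] is then rounded up to a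
     positive integer. *)
  exists (Num.trunc (B + 1)).+1 => // x Cx.
  apply: le_trans (ltW (truncnS_gt (B + 1))).
  by apply: CB Cx; rewrite ltrDl.
have /choice[g gP] : forall x, exists jy : 'I_J * 'cV[R]_d,
    C x -> C jy.2 /\ x = f jy.1 jy.2.
  (* Outside [C] the pair is an arbitrary default. *)
  move=> x; have [Cx|nCx] := pselect (C x); last by exists (j0, 0).
  by have [j [y yP]] := Cpre _ Cx; exists (j, y).
by exists (fst \o g), (snd \o g).
Qed.

(** The constant is fixed before [tau], so it is uniform over all admissible rates. Since [q] is at
    least 1, comparing [ifs_dim tau] with [d] decides which power is the minimum, and only the
    matching count is carried out. *)
Lemma short_periodic_address {R : realType} {d J : nat}
    {f : 'I_J -> 'cV[R]_d -> 'cV[R]_d} {C : set 'cV[R]_d} :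
  is_attractor f C -> unimodular f ->
  exists2 K : R, 0 < K &
    forall tau : 'I_J -> R, contraction_rates f tau ->
    forall (p : 'cV[int]_d) (q : nat), (0 < q)%N -> C (vec_frac p q) ->
    exists (w : nat -> 'I_J) (m n : nat),
      [/\ is_address f w (vec_frac p q), periodic_after w m n &
          (m + n)%:R <= K * Num.min (q%:R `^ ifs_dim tau) (q%:R ^+ d)].
Proof.
move=> C_attr funi.
have [J_gt0 [M M_gt0 CM] [letter [pre Cpre]]] :=
  attractor_backward_orbits C_attr.
have [S S_gt0 SP] := unimodular_common_denominator funi.
(* The factor 3 absorbs the [+ 1] in the coordinate count: [2 * (Q * M) + 1 <= 3 * (Q * M) = E * q].
   It also dominates the factor [2 * (S * M)] of the word count. *)
pose E := (3 * (S * M))%N.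
have E_gt0 : (0 < E)%N by rewrite !muln_gt0 S_gt0.
exists (J%:R * E%:R ^+ d); first by rewrite mulr_gt0 ?exprn_gt0 ?ltr0n.
move=> tau ftau p q q_gt0 Cpq.
have [t01 ft] := contraction_max_rate J_gt0 ftau.
have /andP[t_gt0 t_lt1] := t01.
have t01' : 0 <= max_rate tau < 1 by rewrite ltW.
pose Q := (q * S)%N; have Q_gt0 : (0 < Q)%N by rewrite muln_gt0 q_gt0.
(* The points of [C] with denominator [Q]: stable under [pre] by the choice of [S], and containing
   [p / q] because [q] divides [Q]. *)
pose P y := C y /\ exists u, y = vec_frac u Q.
have Ppre y : P y -> [/\ `|y| <= M%:R, P (pre y) & y = f (letter y) (pre y)].
  move=> [Cy [u yE]]; have [Cy' yE'] := Cpre y Cy; split=> //; first exact: CM.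
  split=> //; apply: (SP Q (letter y) u) => //; first exact: dvdn_mull.
  by rewrite -yE.
have Ppq : P (vec_frac p q).
  split=> //; exists (S%:Z *: p).
  rewrite /vec_frac map_mxZ scalerA; congr (_ *: _).
  rewrite /= natrM invfM -mulrA -[(Posz S)%:~R]/(S%:R) mulVf ?mulr1//.
  by rewrite pnatr_eq0 -lt0n.
have q_ge1 : 1 <= q%:R :> R by rewrite ler1n.
have [D_le|D_gt] := leP (ifs_dim tau) d%:R.
(* The word count carries a factor (2 S M)^D, which is not bounded uniformly in
   tau; but it is only needed for D <= d, where it is at most (2 S M)^d. *)
- have L_ge1 : 1 <= (2 * (Q * M))%:R :> R.
    by rewrite ler1n !muln_gt0 q_gt0 S_gt0.
  have [k tk Jk] := word_length J _ _ J_gt0 t01 L_ge1.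
  have [code codeI] := word_code P letter pre Q M k (ltW t_gt0) ft Ppre Q_gt0
    (fun y Py => Py.2) tk.
  have [w [m [n [wP per mn]]]] := backward_orbit_address P letter pre code _
    t01' ft Ppre codeI Ppq.
  exists w, m, n; split=> //.
  rewrite card_ffun !card_ord in mn.
  rewrite min_l; last by rewrite -powR_mulrn// ler_powR.
  apply: le_trans (_ : (J ^ k)%:R <= _); first by rewrite ler_nat.
  apply: le_trans Jk _; rewrite -mulrA ler_wpM2l// -/(ifs_dim tau).
  have -> : (2 * (Q * M))%:R = (2 * (S * M))%:R * q%:R :> R.
    by rewrite -natrM /Q; congr _%:R; lia.
  rewrite powRM// ler_wpM2r ?powR_ge0//.
  have LE : (2 * (S * M))%:R <= E%:R :> R by rewrite ler_nat /E; lia.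
  apply: le_trans (_ : (2 * (S * M))%:R `^ d%:R <= _).
    by rewrite ler_powR// ler1n !muln_gt0 S_gt0.
  by rewrite powR_mulrn// lerXn2r ?nnegrE.
- have [code codeI] := coordinate_code (R := R) d Q M Q_gt0.
  have {}codeI y z : P y -> P z -> code y = code z -> y = z.
    move=> Py Pz; have [[yM _ _] [zM _ _]] := (Ppre _ Py, Ppre _ Pz).
    case: Py Pz yM zM => _ [u ->] [_ [v ->]]; exact: codeI.
  have [w [m [n [wP per mn]]]] := backward_orbit_address P letter pre code _
    t01' ft Ppre codeI Ppq.
  exists w, m, n; split=> //.
  rewrite card_ffun !card_ord in mn.
  rewrite min_r; last by rewrite -powR_mulrn// ler_powR// ltW.
  rewrite -mulrA -exprMn -natrM -natrX -natrM ler_nat.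
  apply: leq_trans mn (leq_trans _ (leq_pmull _ J_gt0)).
  have [d0|d_gt0] := posnP d; first by rewrite d0 !expn0.
  rewrite leq_exp2r // /Q /E.
  have : (0 < q * S * M)%N by rewrite !muln_gt0 q_gt0 S_gt0.
  lia.
Qed.

Theorem theorem4p3 (R : realType) (d J : nat) (d_gt0 : (0 < d)%N)
    (f : 'I_J -> 'cV[R]_d -> 'cV[R]_d) (C : set 'cV[R]_d)
    (f_ifs : is_ifs f) (f_affine : affine_ifs f)
    (f_rat : rational_preserving f) (C_attr : is_attractor f C) :
  (forall x, C x ->
     (exists w, is_address f w x /\ ultimately_periodic w) ->
     rational_vectors R d x) /\
  (unimodular f ->
     C `&` rational_vectors R d =
       [set x | C x /\ exists w, is_address f w x /\ ultimately_periodic w] /\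
     exists K : R, 0 < K /\
       forall tau : 'I_J -> R, contraction_rates f tau ->
       forall (p : 'cV[int]_d) (q : nat), (0 < q)%N -> C (vec_frac p q) ->
       exists (w : nat -> 'I_J) (m n : nat),
         [/\ is_address f w (vec_frac p q), periodic_after w m n &
             (m + n)%:R <= K * Num.min (q%:R `^ ifs_dim tau) (q%:R ^+ d)]).
Proof.
have sound x : C x ->
    (exists w, is_address f w x /\ ultimately_periodic w) ->
    rational_vectors R d x.
  by move=> _ [w [wx wper]]; exact: periodic_address_rational wx wper.
split=> // funi.
have [K K_gt0 short] := short_periodic_address C_attr funi.
split; last by exists K.
apply/seteqP; split=> x [Cx]; last by move=> wx; split=> //; exact: sound.
move=> /rational_vector_frac[p [q [q_gt0 xE]]]; split=> //.
(* Any admissible rates serve here: only the existence of a periodic address is kept, and the length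
   bound is dropped. *)
have [tau ftau] := f_ifs; rewrite xE in Cx *.
have [w [m [n [wP per _]]]] := short tau ftau p q q_gt0 Cx.
by exists w; split=> //; exists m, n.
Qed.
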